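(* Let $\mathbb{F}$ be a field, let $V$ be an $n$-dimensional vector space over $\mathbb{F}$ with $n\geq 2$, and let $P=(P_0,\dots,P_n)$ be a projective frame of $\mathbb{P}(V)$. For $0\leq k\leq n$ define the split maximal torus $T_k=\mathrm{PStab}(\{P_i:i\neq k\})$ of $\mathrm{PGL}(V)$ and the closed subgroup $H_k=\mathrm{PStab}(\{P_i: i>k\})$ of $\mathrm{PGL}(V)$. Then for every $0\leq k\leq n$, \[T_k\cdots T_0=\{g\in H_k: g^{-1}(P)\rightsquigarrow P\}=\{g\in H_k: P\rightsquigarrow g(P)\}.\] If $\mathbb{F}$ is algebraically closed, then $T_k\cdots T_0$ is nonempty and Zariski open in the closed subgroup $H_k$, i.e. $T_k,\dots,T_0$ induce a dense packing of $H_k$. In particular, $T_n,\dots,T_0$ induce a dense packing in $\mathrm{PGL}(V)$.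
   Context: $\mathbb{P}(V)$ is the projectivisation of $V$, whose points are the $1$-dimensional subspaces of $V$. A set of points is projectively independent if the corresponding $1$-dimensional subspaces are linearly independent. A projective frame of $\mathbb{P}(V)$, $\dim V=n$, is an ordered tuple $(P_0,\dots,P_n)$ of points any $n$ of which are projectively independent. $\mathrm{PGL}(V)=\mathrm{GL}(V)/\{\lambda\,\mathrm{id}_V:\lambda\in\mathbb{F}^\times\}$ acts on $\mathbb{P}(V)$ from the left, hence entrywise on projective frames. For $\mathcal{P}\subseteq\mathbb{P}(V)$, $\mathrm{PStab}(\mathcal{P})=\{g\in\mathrm{PGL}(V): g(X)=X \text{ for all } X\in\mathcal{P}\}$ is the pointwise stabiliser. For projective frames $Q=(Q_0,\dots,Q_n)$ and $P=(P_0,\dots,P_n)$ of $\mathbb{P}(V)$, write $Q\rightsquigarrow P$ if $(Q_0,\dots,Q_k,P_{k+1},\dots,P_n)$ is a projective frame for every $0\leq k<n$. $T_k\cdots T_0=\{t_k\cdots t_0: t_i\in T_i\}$. Subgroups $T_k,\dots,T_0$ of $H$ induce a dense packing of (in) $H$ if the multiplication map $T_k\times\dots\times T_0\to H$, $(t_k,\dots,t_0)\mapsto t_k\cdots t_0$, is injective and its image is Zariski dense in $H$. *)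

(* Defs.v *)
From HB Require Import structures.
From mathcomp Require Import all_boot all_order all_algebra.
From mathcomp Require Import all_classical topology_structure.
From mathcomp Require Import mpoly.

Set Implicit Arguments.
Unset Strict Implicit.
Unset Printing Implicit Defensive.

Import GRing.Theory.
Local Open Scope classical_set_scope.
Local Open Scope ring_scope.
Local Open Scope quotient_scope.

Section ProjectiveSpace.
Variables (F : fieldType) (V : vectType F).

Record ppoint := PPoint { pline :> {vspace V}; _ : \dim pline == 1%N }.

HB.instance Definition _ := [isSub for pline].
HB.instance Definition _ := [Choice of ppoint by <:].

Lemma dim_ppoint (X : ppoint) : \dim X = 1%N.
Proof. by case: X => U /= /eqP. Qed.

(* Linear independence of the lines [P j], [j \in J], is directness of their
   sum; it forces the points indexed by [J] to be pairwise distinct. *)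
Definition proj_independent (I : finType) (P : I -> ppoint) (J : {set I}) :=
  directv (\sum_(j in J) (P j : {vspace V}))%VS.

Definition projective_frame n (P : 'I_n.+1 -> ppoint) :=
  forall J : {set 'I_n.+1}, #|J| = n -> proj_independent P J.

Definition frame_arrow n (Q P : 'I_n.+1 -> ppoint) :=
  forall k : nat, (k < n)%N ->
    projective_frame (fun i : 'I_n.+1 => if (i <= k)%N then Q i else P i).

End ProjectiveSpace.

Notation "Q ~~> P" := (frame_arrow Q P) (at level 70).

Section GeneralLinear.
Variables (F : fieldType) (V : vectType F).

(* The library's ring structure on ['End(V)] composes in the opposite order and
   excludes [V = 0]; hence a separate type, with [f * g] the composite f o g, so
   that GL(V) acts on V from the left. *)
Record GL := MkGL { GLval :> 'End(V); _ : lker GLval == 0%VS }.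

HB.instance Definition _ := [isSub for GLval].
HB.instance Definition _ := [Choice of GL by <:].

Lemma GL_ker (f : GL) : lker f == 0%VS. Proof. by case: f. Qed.

Fact GL1_ker : lker (\1%VF : 'End(V)) == 0%VS.
Proof. by apply/lker0P => u v; rewrite !id_lfunE. Qed.

Fact GLM_ker (f g : GL) : lker (f \o g)%VF == 0%VS.
Proof.
apply/lker0P => u v; rewrite !comp_lfunE => e.
by apply: (lker0P (GL_ker g)); apply: (lker0P (GL_ker f)).
Qed.

Fact GLV_ker (f : GL) : lker (f^-1)%VF == 0%VS.
Proof.
by apply/lker0P; apply: (can_inj (g := f)) => u; exact: (lker0_lfunVK (GL_ker f)).
Qed.

Definition GL_one := MkGL GL1_ker.
Definition GL_mul f g := MkGL (GLM_ker f g).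
Definition GL_inv f := MkGL (GLV_ker f).

Fact GL_mulA : associative GL_mul.
Proof. by move=> f g h; apply: val_inj; rewrite /= comp_lfunA. Qed.
Fact GL_mul1 : left_id GL_one GL_mul.
Proof. by move=> f; apply: val_inj; rewrite /= comp_lfun1l. Qed.
Fact GL_mulV : left_inverse GL_one GL_inv GL_mul.
Proof. by move=> f; apply: val_inj; rewrite /= lker0_compVf ?GL_ker. Qed.
Fact GL_mulr1 : right_id GL_one GL_mul.
Proof. by move=> f; apply: val_inj; rewrite /= comp_lfun1r. Qed.
Fact GL_mulrV : right_inverse GL_one GL_inv GL_mul.
Proof. by move=> f; apply: val_inj; rewrite /= lker0_compfV ?GL_ker. Qed.

HB.instance Definition _ :=
  isGroup.Build GL GL_mulA GL_mul1 GL_mulr1 GL_mulV GL_mulrV.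

(* Zariski topology: GL(V) carries the topology induced from the affine space
   ['End(V)], whose closed sets are the zero loci of sets of polynomials in the
   coordinates. Linear changes of coordinates do not affect it. *)
Definition GL_coord (f : GL) : 'I_(\dim {:'End(V)}) -> F :=
  fun i => coord (vbasis {:'End(V)}) i (f : 'End(V)).

Definition GL_zeros (S : set {mpoly F[\dim {:'End(V)}]}) : set GL :=
  [set f | forall p, S p -> p.@[GL_coord f] = 0].

Definition GL_open (U : set GL) := exists S, ~` U = GL_zeros S.

Fact GL_openT : GL_open setT.
Proof.
exists setT; rewrite setCT; apply/esym; rewrite -subset0 => f /(_ 1 I).
by rewrite meval1 => /eqP; rewrite oner_eq0.
Qed.

Fact GL_openI : setI_closed GL_open.
Proof.
move=> A B [S eS] [T eT].
exists [set p | exists q r, [/\ S q, T r & p = q * r]].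
rewrite setCI eS eT; apply/seteqP; split => [f [h|h] p [q [r [Sq Tr ->]]]|f h].
- by rewrite mevalM h ?mul0r.
- by rewrite mevalM (h r) ?mulr0.
apply: contrapT => /not_orP[/existsNP[q /not_implyP[Sq fq]]].
move=> /existsNP[r /not_implyP[Tr fr]].
have /eqP := h (q * r) (ex_intro _ q (ex_intro _ r (And3 Sq Tr erefl))).
by rewrite mevalM mulf_eq0 => /orP[] /eqP.
Qed.

Fact GL_open_bigcup (I : Type) (f : I -> set GL) :
  (forall i, GL_open (f i)) -> GL_open (\bigcup_i f i).
Proof.
move=> /choice[S eS]; exists (\bigcup_i S i); rewrite setC_bigcup.
apply/seteqP; split => g h.
  by move=> p [i _ Sp]; have := h i Logic.I; rewrite eS; exact.
by move=> i _; rewrite eS => p Sp; apply: h; exists i.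
Qed.

HB.instance Definition _ :=
  isOpenTopological.Build GL GL_openT GL_openI GL_open_bigcup.

Lemma GL_closedP (A : set GL) : closed A <-> exists S, A = GL_zeros S.
Proof. by rewrite -openC; split=> -[S e]; exists S; move: e; rewrite setCK. Qed.

Definition homothetic (f g : GL) :=
  `[< exists2 c : F, c != 0 & (f : 'End(V)) = c *: (g : 'End(V)) >].

Fact homothetic_refl : reflexive homothetic.
Proof. by move=> f; apply/asboolP; exists 1; rewrite ?oner_eq0 ?scale1r. Qed.

Fact homothetic_sym : ssrbool.symmetric homothetic.
Proof.
suff sub f g : homothetic f g -> homothetic g f by move=> f g; apply/idP/idP => /sub.
move=> /asboolP[c c0 e]; apply/asboolP; exists c^-1; first by rewrite invr_eq0.
by rewrite e scalerK.
Qed.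

Fact homothetic_trans : transitive homothetic.
Proof.
move=> g f h /asboolP[c c0 e] /asboolP[d d0 e']; apply/asboolP.
by exists (c * d); rewrite ?mulf_neq0 // e e' scalerA.
Qed.

Canonical homothetic_equiv :=
  EquivRel homothetic homothetic_refl homothetic_sym homothetic_trans.

(* The quotient group GL(V) / F^*, with the quotient of the Zariski topology of
   GL(V). *)
Definition PGL : Type := {eq_quot homothetic}.

HB.instance Definition _ := Choice.on PGL.
HB.instance Definition _ := EqQuotient.on PGL.
Definition PGL_open (U : set PGL) := open (\pi_PGL @^-1` U : set GL).

Fact PGL_openT : PGL_open setT.
Proof. by rewrite /PGL_open preimage_setT; exact: openT. Qed.
Fact PGL_openI : setI_closed PGL_open.
Proof. by move=> A B oA oB; exact: openI. Qed.
Fact PGL_open_bigcup (I : Type) (f : I -> set PGL) :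
  (forall i, PGL_open (f i)) -> PGL_open (\bigcup_i f i).
Proof. by move=> of_; apply: bigcup_open => i _; exact: of_. Qed.

HB.instance Definition _ :=
  isOpenTopological.Build PGL PGL_openT PGL_openI PGL_open_bigcup.

Local Open Scope group_scope.

Definition PGL_one : PGL := \pi_PGL 1.
Definition PGL_mul (g h : PGL) : PGL := \pi_PGL (repr g * repr h).
Definition PGL_inv (g : PGL) : PGL := \pi_PGL (repr g)^-1.

Lemma PGL_piP (f g : GL) :
  reflect (exists2 c : F, c != 0%R & (f : 'End(V)) = (c *: (g : 'End(V)))%R)
          (\pi_PGL f == \pi_PGL g).
Proof. by rewrite pi_eq_quot; apply: asboolP. Qed.

Lemma repr_piP (f : GL) :
  exists2 c : F, c != 0%R & (repr (\pi_PGL f) : 'End(V)) = (c *: (f : 'End(V)))%R.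
Proof. by apply/PGL_piP; rewrite reprK. Qed.

Lemma PGL_mul_pi (f g : GL) : PGL_mul (\pi_PGL f) (\pi_PGL g) = \pi_PGL (f * g).
Proof.
apply/eqP/PGL_piP; have [c c0 ec] := repr_piP f; have [d d0 ed] := repr_piP g.
exists (c * d)%R; first exact: mulf_neq0.
by rewrite /= ec ed -comp_lfunZl -comp_lfunZr scalerA.
Qed.

Lemma PGL_inv_pi (f : GL) : PGL_inv (\pi_PGL f) = \pi_PGL f^-1.
Proof.
apply/eqP/PGL_piP; have [c c0 ec] := repr_piP f.
exists (c^-1)%R; first by rewrite invr_eq0.
have e : (f : 'End(V)) = (c^-1 *: (repr (\pi_PGL f) : 'End(V)))%R by rewrite ec scalerK.
set h := repr _ in e *.
rewrite -[LHS]comp_lfun1r -(lker0_compfV (GL_ker f)) comp_lfunA.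
rewrite [X in ((_ \o X) \o _)%VF]e -comp_lfunZr -comp_lfunZl.
by rewrite lker0_compVf ?GL_ker // comp_lfun1l.
Qed.

Lemma PGLW (A : PGL -> Prop) : (forall f : GL, A (\pi_PGL f)) -> forall g, A g.
Proof. by move=> h g; rewrite -[g]reprK. Qed.

Fact PGL_mulA : associative PGL_mul.
Proof.
by elim/PGLW => f; elim/PGLW => g; elim/PGLW => h; rewrite !PGL_mul_pi mulgA.
Qed.
Fact PGL_mul1 : left_id PGL_one PGL_mul.
Proof. by elim/PGLW => f; rewrite PGL_mul_pi mul1g. Qed.
Fact PGL_mulr1 : right_id PGL_one PGL_mul.
Proof. by elim/PGLW => f; rewrite PGL_mul_pi mulg1. Qed.
Fact PGL_mulV : left_inverse PGL_one PGL_inv PGL_mul.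
Proof. by elim/PGLW => f; rewrite PGL_inv_pi PGL_mul_pi mulVg. Qed.
Fact PGL_mulrV : right_inverse PGL_one PGL_inv PGL_mul.
Proof. by elim/PGLW => f; rewrite PGL_inv_pi PGL_mul_pi mulgV. Qed.

HB.instance Definition _ :=
  isGroup.Build PGL PGL_mulA PGL_mul1 PGL_mulr1 PGL_mulV PGL_mulrV.

Fact GL_act_dim (f : GL) (X : ppoint V) : \dim (f @: X)%VS == 1%N.
Proof.
by rewrite limg_dim_eq ?dim_ppoint // (eqP (GL_ker f)) capv0.
Qed.

Definition GL_act (f : GL) (X : ppoint V) : ppoint V := PPoint (GL_act_dim f X).
Definition PGL_act (g : PGL) (X : ppoint V) : ppoint V := GL_act (repr g) X.

Lemma PGL_act_pi (f : GL) X : PGL_act (\pi_PGL f) X = GL_act f X.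
Proof.
apply/val_inj/eqP; rewrite /= eqEdim (eqP (GL_act_dim f X)).
rewrite (eqP (GL_act_dim _ X)) leqnn andbT; have [c c0 ->] := repr_piP f.
apply/subvP => _ /memv_imgP[u Xu ->].
by rewrite scale_lfunE -linearZ memv_img ?memvZ.
Qed.

Lemma PGL_act1 X : PGL_act 1 X = X.
Proof. by rewrite PGL_act_pi; apply: val_inj; rewrite /= lim1g. Qed.

Lemma PGL_actM g h X : PGL_act (g * h) X = PGL_act g (PGL_act h X).
Proof.
elim/PGLW: g => f; elim/PGLW: h => h.
by rewrite [_ * _]PGL_mul_pi !PGL_act_pi; apply: val_inj; rewrite /= limg_comp.
Qed.

Definition PStab (A : set (ppoint V)) : set PGL :=
  [set g | forall X, A X -> PGL_act g X = X].

(* The group of F-points of a split maximal torus of PGL(V): the image of the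
   full group of automorphisms of V that are diagonal in some basis. *)
Definition split_maximal_torus (T : set PGL) :=
  exists2 e : (\dim {:V}).-tuple V, basis_of {:V} e &
    T = [set \pi_PGL f | f in [set f : GL |
           forall i, exists c : F, f (tnth e i) = (c *: tnth e i)%R]].

End GeneralLinear.

Section DensePacking.
Local Open Scope group_scope.

(* [packing_map [t_0, .., t_(m-1)] = t_(m-1) * ... * t_0] *)
Definition packing_map (G : groupType) m (t : 'I_m -> G) : G :=
  \prod_(i < m) t (rev_ord i).

Definition packing_dom (G : groupType) m (T : 'I_m -> set G) : set ('I_m -> G) :=
  [set t | forall i, T i (t i)].

Definition packing_set (G : groupType) m (T : 'I_m -> set G) : set G :=
  @packing_map G m @` packing_dom T.

Definition is_subgroup (G : groupType) (H : set G) := group_closed (mem H).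

Lemma is_subgroupP (G : groupType) (H : set G) :
  is_subgroup H <-> H 1 /\ forall g h, H g -> H h -> H (g / h).
Proof.
split=> [[h1 hd]|[h1 hd]]; split; rewrite ?inE.
- by move: h1; rewrite inE.
- by move=> g h Hg Hh; have := hd g h; rewrite !inE; apply.
- exact: h1.
- by move=> g h; rewrite !inE; apply: hd.
Qed.

Variables (F : fieldType) (V : vectType F).

Definition open_in (H A : set (PGL V)) := exists2 U, open U & A = H `&` U.

Definition dense_in (H A : set (PGL V)) := A `<=` H /\ H `<=` closure A.

Definition dense_packing m (T : 'I_m -> set (PGL V)) (H : set (PGL V)) :=
  [/\ is_subgroup H,
      forall i, is_subgroup (T i) /\ T i `<=` H,
      set_inj (packing_dom T) (@packing_map _ m) &
      dense_in H (packing_set T)].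

Definition frame_torus n (P : 'I_n.+1 -> ppoint V) (k : 'I_n.+1) : set (PGL V) :=
  PStab [set P i | i in [set i | i != k]].

Definition frame_stab n (P : 'I_n.+1 -> ppoint V) (k : 'I_n.+1) : set (PGL V) :=
  PStab [set P i | i in [set i : 'I_n.+1 | (k < i)%N]].

(* The tuple (T_0, .., T_k). *)
Definition frame_tori n (P : 'I_n.+1 -> ppoint V) (k : 'I_n.+1) :
    'I_k.+1 -> set (PGL V) :=
  fun i => frame_torus P (widen_ord (ltn_ord k) i).

End DensePacking.

Arguments frame_tori {F V n} P k i.

(* Main.v *)
From HB Require Import structures.
Require Import Defs.
From mathcomp Require Import all_boot all_order all_algebra.
From mathcomp Require Import all_classical topology_structure.
From mathcomp Require Import mpoly.
Local Open Scope classical_set_scope.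

(* A frame consists of the lines of vectors u_0, .., u_n with sum 0, any n of
   which form a basis; hence PGL(V) acts simply transitively on frames. If
   g = t_k ... t_0, then h_j = t_0^-1 ... t_(j-1)^-1 carries P to
   (g^-1 P_0, .., g^-1 P_(j-1), P_j, .., P_n), because t_i moves only P_i among
   the points of P. These tuples are thus frames; they determine the h_j, hence
   the t_i. Conversely, if all of them are frames, simple transitivity yields the
   h_j, and t_j = h_(j+1)^-1 h_j. Being a frame is the nonvanishing of
   determinants, so the image is open in H_k; it is dense since H_k comes from a
   linear subspace of End(V), on whose lines two nonzero polynomials over an
   infinite field have a common nonroot. *)

Set Implicit Arguments.
Unset Strict Implicit.
Unset Printing Implicit Defensive.

(** * Frames and the simply transitive action of PGL(V) on them *)

Section Frames.
Import GRing.Theory.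
Local Open Scope ring_scope.
Variables (F : fieldType) (V : vectType F).
Local Notation n := (\dim {:V}).
Implicit Types (Q R : 'I_n.+1 -> ppoint V) (g : PGL V) (f : GL V).

(** A set of n indices is the complement of a single one, and n lines in dimension n are independent
    exactly when they span. *)
Lemma frame_fullvP Q :
  projective_frame Q <-> forall m, (\sum_(j | j != m) (Q j : {vspace V}))%VS = fullv.
Proof.
have dirE m : proj_independent Q (finset.setC (finset.set1 m)) <->
    (\sum_(j | j != m) (Q j : {vspace V}))%VS = fullv.
  rewrite /proj_independent directvE /=.
  under [X in _ == X]eq_bigr do rewrite dim_ppoint.
  rewrite sum1_card cardsC1 card_ord /=.
  rewrite (eq_bigl (fun j => j != m)); last by move=> j; rewrite in_setC1.
  split=> [/eqP d|->] //; apply/eqP; rewrite eqEdim subvf /=.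
  by rewrite -[X in (X <= _)%N]d leqnn.
split=> [h m|h J cJ]; first by apply/dirE/h; rewrite cardsC1 card_ord.
have : #|finset.setC J| == 1%N.
  have := finset.cardsC J; rewrite cJ card_ord => e.
  by apply/eqP/(@addnI n); rewrite e addn1.
by move=> /cards1P[m eJ]; rewrite -(finset.setCK J) eJ; apply/dirE.
Qed.

Definition coord_det (u : 'I_n -> V) : F :=
  \det (\matrix_(i < n, j < n) coord (vbasis {:V}) j (u i)).

Lemma free_mktuple_fullv (u : 'I_n -> V) :
  free [tuple u i | i < n] = (<<[tuple u i | i < n]>>%VS == fullv).
Proof. by rewrite /free size_tuple eqEdim subvf eqn_leq dimvS ?subvf. Qed.

Lemma coord_det_neq0 (u : 'I_n -> V) :
  (coord_det u != 0) = free [tuple u i | i < n].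
Proof.
have relE (c : 'I_n -> F) :
    (\row_i c i *m \matrix_(i < n, j < n) coord (vbasis {:V}) j (u i) == 0) =
    (\sum_i c i *: u i == 0).
  apply/eqP/eqP => e.
    rewrite (coord_vbasis (memvf (\sum_i c i *: u i))) big1 // => j _.
    have := congr1 (fun M : 'rV_n => M ord0 j) e; rewrite !mxE.
    rewrite linear_sum /= => e'.
    rewrite (eq_bigr (fun i => c i * coord (vbasis {:V}) j (u i))).
      rewrite [X in X *: _](_ : _ = 0) ?scale0r // -[RHS]e'.
      by apply: eq_bigr => i _; rewrite !mxE.
    by move=> i _; rewrite linearZ.
  apply/matrixP => k j; rewrite !mxE.
  transitivity (coord (vbasis {:V}) j (\sum_i c i *: u i)).
    by rewrite linear_sum; apply: eq_bigr => i _; rewrite !mxE linearZ.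
  by rewrite e linear0.
apply/idP/freeP => [d0 c e i|h].
  apply/eqP; apply: contraNT d0 => ci; apply/det0P; exists (\row_i c i).
    by apply/eqP => /rowP/(_ i); rewrite !mxE => /eqP; exact/negP.
  apply/eqP; rewrite relE; apply/eqP; rewrite -[RHS]e; apply: eq_bigr => l _.
  by rewrite -tnth_nth tnth_mktuple.
apply/negP => /det0P[v /eqP v0 e]; apply: v0; apply/rowP => i; rewrite mxE.
apply: (h (v ord0)); have := relE (v ord0).
rewrite (_ : \row_i v ord0 i = v) ?e ?eqxx; last by apply/rowP => j; rewrite mxE.
move=> /esym/eqP e'; rewrite -[RHS]e'; apply: eq_bigr => l _.
by rewrite -tnth_nth tnth_mktuple.
Qed.

Lemma span_mktuple (u : 'I_n -> V) :
  <<[tuple u i | i < n]>>%VS = (\sum_i <[u i]>)%VS.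
Proof. by rewrite span_def big_tuple; apply: eq_bigr => i _; rewrite tnth_mktuple. Qed.

Lemma sumv_lift (U : 'I_n.+1 -> {vspace V}) m :
  (\sum_(j | j != m) U j = \sum_(i < n) U (lift m i))%VS.
Proof.
apply/eqP; rewrite eqEsubv; apply/andP; split; apply/subv_sumP => i h.
  by move: h; rewrite eq_sym => /unlift_some[j -> _]; exact: (sumv_sup j).
by apply: (sumv_sup (lift m i)) => //; rewrite eq_sym neq_lift.
Qed.

Lemma frame_freeP (u : 'I_n.+1 -> V) Q :
  (forall i, Q i = <[u i]>%VS :> {vspace V}) ->
  projective_frame Q <-> forall m : 'I_n.+1, free [tuple u (lift m i) | i < n].
Proof.
move=> Qu; have e (m : 'I_n.+1) : free [tuple u (lift m i) | i < n] =
    ((\sum_(j | j != m) (Q j : {vspace V}))%VS == fullv).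
  rewrite free_mktuple_fullv span_mktuple sumv_lift.
  by congr (_ == _); apply: eq_bigr => i _; rewrite Qu.
split=> [/frame_fullvP h m|h]; first by rewrite e h.
by apply/frame_fullvP => m; apply/eqP; rewrite -e.
Qed.

Lemma ppoint_vector (X : ppoint V) (v : V) : v \in (X : {vspace V}) -> v != 0 ->
  X = <[v]>%VS :> {vspace V}.
Proof.
move=> Xv v0; apply/esym/eqP; rewrite eqEdim -memvE Xv dim_vline v0 /=.
by rewrite dim_ppoint.
Qed.

Lemma ppoint_vector_neq0 (X : ppoint V) (v : V) :
  X = <[v]>%VS :> {vspace V} -> v != 0.
Proof. by move=> e; have := dim_ppoint X; rewrite e dim_vline; case: eqP. Qed.

(** A nonzero [w] in [Q ord0] is a sum of vectors of the other lines; these and [- w] are the [u i].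
    Were some [u i] zero, [Q ord0] would lie in the span of the n - 1 lines other than itself and
    [Q i], so the n lines other than [Q i] could not span. *)
Lemma frame_normalized Q : projective_frame Q ->
  exists2 u : 'I_n.+1 -> V,
    forall i, Q i = <[u i]>%VS :> {vspace V} & \sum_i u i = 0.
Proof.
move=> fQ; have /frame_fullvP full := fQ.
pose w := vpick (Q ord0).
have w0 : w != 0 by rewrite vpick0 -dimv_eq0 dim_ppoint.
have Qw := memv_pick (Q ord0); rewrite -/w in Qw.
have /memv_sumP[v Qv ew] : w \in (\sum_(j | j != ord0) (Q j : {vspace V}))%VS.
  by rewrite full memvf.
pose u i := if i == ord0 then - w else v i.
have su : \sum_i u i = 0.
  rewrite (bigD1 ord0) //= /u eqxx [in X in _ + X = _](eq_bigr v) => [|i /negbTE ->//].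
  by rewrite -ew addNr.
have Qu i : u i \in (Q i : {vspace V}).
  by rewrite /u; case: eqP => [->|/eqP /Qv//]; rewrite rpredN.
exists u => // i; apply: ppoint_vector => //; apply/eqP => ui0.
have i0 : i != ord0.
  apply/eqP => i0; move: ui0; rewrite i0 /u eqxx => /eqP.
  by rewrite oppr_eq0; exact/negP.
have sub : (\sum_(j | j != i) (Q j : {vspace V}) <=
    \sum_(j | (j != ord0) && (j != i)) (Q j : {vspace V}))%VS.
  apply/subv_sumP => j ji; have [j0|j0] := eqVneq j ord0; last first.
    by apply: (sumv_sup j); rewrite ?ji ?j0.
  rewrite j0 (ppoint_vector Qw w0) -memvE ew (bigD1 i) //=.
  have -> : v i = 0 by move: ui0; rewrite /u (negbTE i0).
  by rewrite add0r; apply: memv_sumr => l /andP[l0 _]; rewrite Qv.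
have := dimvS sub; rewrite full leqNgt; apply/negP; rewrite negbK.
apply: leq_ltn_trans (dimv_leq_sum _ _ _) _.
under eq_bigr do rewrite dim_ppoint.
rewrite sum1_card; have cn : #|predC1 i| = n by rewrite cardC1 card_ord.
rewrite -[ltnRHS]cn.
rewrite [in ltnRHS](cardD1 ord0) inE /= eq_sym i0 add1n ltnS.
by apply/subset_leq_card/fintype.subsetP => j; rewrite !inE.
Qed.

Lemma GL_act_vector f (X : ppoint V) (v : V) :
  X = <[v]>%VS :> {vspace V} -> GL_act f X = <[(f : 'End(V)) v]>%VS :> {vspace V}.
Proof. by move=> /= ->; rewrite limg_line. Qed.

Lemma GL_limg_fullv f : (f @: fullv)%VS = fullv.
Proof. exact/lker0_limgf/GL_ker. Qed.

Lemma frame_act g Q :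
  projective_frame Q -> projective_frame (fun i => PGL_act g (Q i)).
Proof.
elim/PGLW: g => f /frame_fullvP full; apply/frame_fullvP => m.
under eq_bigr do rewrite PGL_act_pi /=.
by rewrite -limg_sum full GL_limg_fullv.
Qed.

Lemma full_GL (f : 'End(V)) : (f @: fullv)%VS = fullv -> lker f == 0%VS.
Proof.
move=> ff; have := limg_ker_dim f fullv; rewrite ff capfv.
by move=> /(congr1 (subn^~ n)); rewrite addnK subnn => /eqP; rewrite dimv_eq0.
Qed.

(** The linear map that matches the normalized vectors of positive index also matches those of index
    0, because both families sum to zero. *)
Lemma frame_transitive Q R : projective_frame Q -> projective_frame R ->
  exists g, forall i, PGL_act g (Q i) = R i.
Proof.
move=> fQ fR; have [u Qu su] := frame_normalized fQ.
have [w Rw sw] := frame_normalized fR.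
have /(_ ord0) freeu := (frame_freeP Qu).1 fQ.
have /(_ ord0) := (frame_freeP Rw).1 fR.
rewrite free_mktuple_fullv => /eqP spanw.
set X := [tuple u _ | _ < n] in freeu; set Y := [tuple w _ | _ < n] in spanw.
have [h /(_ freeu)] := linear_of_free X Y; rewrite !size_tuple => /(_ erefl) hXY.
have huw i : h (u (lift ord0 i)) = w (lift ord0 i).
  have := congr1 (fun s => nth 0 s i) hXY.
  by rewrite (nth_map 0) ?size_tuple // -!tnth_nth !tnth_mktuple.
have huw0 i : h (u i) = w i.
  have [i' ->|->] := unliftP ord0 i; first exact: huw.
  move: su sw; rewrite !big_ord_recl => /eqP; rewrite addr_eq0 => /eqP -> /eqP.
  rewrite addr_eq0 => /eqP ->; rewrite linearN linear_sum; congr (- _).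
  exact: eq_bigr.
have kh : lker (linfun h) == 0%VS.
  apply: full_GL; apply/eqP; rewrite eqEsubv subvf -[X in (X <= _)%VS]spanw.
  apply/span_subvP => _ /tnthP[i ->]; rewrite tnth_mktuple -huw -(lfunE h).
  exact: memv_img (memvf _).
exists (\pi_(PGL V) (MkGL kh))%qT => i; apply: val_inj; rewrite PGL_act_pi /=.
by rewrite Qu Rw limg_line lfunE /= huw0.
Qed.

Lemma GL_act_fixP f (X : ppoint V) (v : V) : X = <[v]>%VS :> {vspace V} ->
  GL_act f X = X <-> (f : 'End(V)) v \in <[v]>%VS.
Proof.
move=> Xv; have fXv := GL_act_vector f Xv; split=> [e|fv].
  by rewrite -Xv -e fXv memv_line.
apply: val_inj; rewrite /= -[LHS]/(GL_act f X : {vspace V}) fXv.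
rewrite -Xv in fv; rewrite (ppoint_vector fv) //.
exact: ppoint_vector_neq0 fXv.
Qed.

(** The [u i] are eigenvectors of a representative [f]. Applying [f] minus the scalar [c ord0] to
    their vanishing sum leaves a relation among the independent vectors of positive index, so all
    eigenvalues agree. *)
Lemma frame_faithful g Q :
  projective_frame Q -> (forall i, PGL_act g (Q i) = Q i) -> g = 1%g.
Proof.
move=> fQ; have [u Qu su] := frame_normalized fQ.
elim/PGLW: g => f fixQ.
have /(_ ord0) freeu := (frame_freeP Qu).1 fQ.
have /choice[c fu] i : exists c, (f : 'End(V)) (u i) = c *: u i.
  by apply/vlineP/(GL_act_fixP _ (Qu i)); rewrite -PGL_act_pi fixQ.
have c0 i : c (lift ord0 i) = c ord0.
  apply/eqP; rewrite -subr_eq0; apply/eqP; move: i.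
  apply: (freeP freeu (fun i => c (lift ord0 i) - c ord0)).
  under eq_bigr do rewrite -tnth_nth tnth_mktuple.
  transitivity ((f : 'End(V)) (\sum_i u i) - c ord0 *: \sum_i u i).
    rewrite linear_sum !big_ord_recl /= fu scalerDr opprD addrACA subrr add0r.
    rewrite scaler_sumr -sumrB; apply: eq_bigr => i _.
    by rewrite fu scalerBl.
  by rewrite su linear0 scaler0 subr0.
have ef : (f : 'End(V)) = c ord0 *: \1%VF.
  move: freeu; rewrite free_mktuple_fullv => /eqP spanu; apply/(fullv_lfunP _ _ spanu).
  by move=> _ /tnthP[i ->]; rewrite tnth_mktuple fu c0 scale_lfunE id_lfunE.
apply/eqP/PGL_piP; exists (c ord0) => //; apply/eqP => c00.
have := ppoint_vector_neq0 (Qu ord0).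
have /lker0P finj := GL_ker f.
by rewrite -(inj_eq finj) linear0 ef c00 scale0r lfunE eqxx.
Qed.
End Frames.

(** * Partial products of inverses in a group *)

Section InverseProducts.
Local Open Scope group_scope.
Variables (G : groupType) (m : nat).
Implicit Types t : 'I_m -> G.

(** Padding by 1 makes the partial products below constant from index [m] on, so that every natural
    number can index them. *)
Definition extend1 t (i : nat) : G := oapp t 1 (insub i).

Lemma extend1_ord t (i : 'I_m) : extend1 t i = t i.
Proof. by rewrite /extend1 valK. Qed.

Lemma extend1_default t i : (m <= i)%N -> extend1 t i = 1.
Proof. by move=> mi; rewrite /extend1 insubF // ltnNge mi. Qed.

(** These are the elements h_j; consecutive ones recover t_j as h_(j+1)^-1 h_j. *)
Definition inv_prod t (j : nat) : G := \prod_(0 <= i < j) (extend1 t i)^-1.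

Lemma inv_prod0 t : inv_prod t 0 = 1.
Proof. by rewrite /inv_prod big_geq. Qed.

Lemma inv_prodS t j : inv_prod t j.+1 = inv_prod t j * (extend1 t j)^-1.
Proof. by rewrite /inv_prod big_nat_recr. Qed.

Lemma invg_prod_rev (s : nat -> G) p :
  (\prod_(i < p) s (rev_ord i))^-1 = \prod_(0 <= i < p) (s i)^-1.
Proof.
elim: p => [|p IH]; first by rewrite big_ord0 big_geq // invg1.
rewrite big_ord_recl invgM big_nat_recr //= -IH subn1 /=; congr (_ ^-1 * _).
Qed.

(** Inversion reverses the decreasing order of the factors in [packing_map], and the padded factors
    are trivial. *)
Lemma inv_prod_packing t j : (m <= j)%N -> inv_prod t j = (packing_map t)^-1.
Proof.
move=> mj; rewrite /inv_prod (big_cat_nat (leq0n m) mj) /= [X in _ * X]big_nat_cond.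
rewrite [X in _ * X]big1 => [|i /andP[/andP[mi _] _]]; last first.
  by rewrite extend1_default ?invg1.
rewrite mulg1 -invg_prod_rev; congr (_^-1); apply: eq_bigr => i _.
by rewrite extend1_ord.
Qed.

End InverseProducts.

(** * Products of torus elements and chains of frames *)

Section Packing.
Local Open Scope group_scope.
Variables (F : fieldType) (V : vectType F).
Local Notation n := (\dim {:V}).
Implicit Types (Q R P : 'I_n.+1 -> ppoint V) (g : PGL V) (A : set (ppoint V)).

Lemma frame_torusP P (k : 'I_n.+1) g :
  frame_torus P k g <-> forall i, i != k -> PGL_act g (P i) = P i.
Proof. by split=> [h i ik|h _ [i ik <-]]; [apply: h; exists i|exact: h]. Qed.

Lemma frame_stabP P (k : 'I_n.+1) g :
  frame_stab P k g <-> forall i : 'I_n.+1, (k < i)%N -> PGL_act g (P i) = P i.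
Proof. by split=> [h i ik|h _ [i ik <-]]; [apply: h; exists i|exact: h]. Qed.

Lemma PGL_actK g : cancel (PGL_act g) (PGL_act g^-1).
Proof. by move=> X; rewrite -PGL_actM mulVg PGL_act1. Qed.

Lemma PGL_actVK g : cancel (PGL_act g^-1) (PGL_act g).
Proof. by move=> X; rewrite -PGL_actM mulgV PGL_act1. Qed.

Lemma PStab_subgroup A : is_subgroup (PStab A).
Proof.
apply/is_subgroupP; split=> [X _|g h gA hA X AX]; first exact: PGL_act1.
by rewrite PGL_actM -{1}(hA X AX) PGL_actK gA.
Qed.

Lemma PGL_act_frame_inj P g h : projective_frame P ->
  (forall i, PGL_act g (P i) = PGL_act h (P i)) -> g = h.
Proof.
move=> fP e; apply/eqP; rewrite -(inj_eq (mulgI h^-1)) mulVg; apply/eqP.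
by apply: (frame_faithful fP) => i; rewrite PGL_actM e PGL_actK.
Qed.

(** Applying [g] to the tuples of the left chain gives those of the right chain, and PGL(V)
    preserves frames. *)
Lemma frame_arrow_act P g :
  (fun i => PGL_act g^-1 (P i)) ~~> P <-> P ~~> (fun i => PGL_act g (P i)).
Proof.
split=> arr l ln.
  have := frame_act g (arr l ln); congr projective_frame.
  by apply/funext => i; case: ifP => // _; rewrite PGL_actVK.
have := frame_act g^-1 (arr l ln); congr projective_frame.
by apply/funext => i; case: ifP => // _; rewrite PGL_actK.
Qed.

Variables (P : 'I_n.+1 -> ppoint V) (k : 'I_n.+1).
Hypothesis fP : projective_frame P.
Implicit Type t : 'I_k.+1 -> PGL V.

Lemma extend1_tori_fix t (l : nat) (i : 'I_n.+1) : packing_dom (frame_tori P k) t ->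
  l != i :> nat -> PGL_act (extend1 t l) (P i) = P i.
Proof.
move=> dt li; have [kl|lk] := ltnP k l.
  by rewrite extend1_default // PGL_act1.
have := (frame_torusP _ _ _).1 (dt (Ordinal (lk : (l < k.+1)%N))) i.
rewrite -(extend1_ord t) /=; apply; rewrite eq_sym.
by apply: contra li => /eqP <-.
Qed.

Lemma extend1_tori_fixV t (l : nat) (i : 'I_n.+1) : packing_dom (frame_tori P k) t ->
  l != i :> nat -> PGL_act (extend1 t l)^-1 (P i) = P i.
Proof. by move=> dt li; rewrite -{1}(extend1_tori_fix dt li) PGL_actK. Qed.

(* [inv_prod t j] carries the frame [P] to the j-th frame of the chain
   certifying that [g^-1 P] leads to [P], where [g = packing_map t]. *)
Lemma inv_prod_act t j (i : 'I_n.+1) : packing_dom (frame_tori P k) t ->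
  PGL_act (inv_prod t j) (P i) =
    if (i < j)%N then PGL_act (packing_map t)^-1 (P i) else P i.
Proof.
(* The rightmost factor acts first, and only the factor of index [i] can move [P i]: the image is
   [P i] up to stage [i] and constant from stage [i.+1] on. *)
move=> dt; have fixi l : (l <= i)%N -> PGL_act (inv_prod t l) (P i) = P i.
  elim: l => [|l IH] li; first by rewrite inv_prod0 PGL_act1.
  rewrite inv_prodS PGL_actM extend1_tori_fixV //; first exact/IH/ltnW.
  by rewrite neq_ltn li.
have const l : (i < l)%N ->
    PGL_act (inv_prod t l) (P i) = PGL_act (inv_prod t i.+1) (P i).
  elim: l => // l IH; rewrite ltnS leq_eqVlt => /predU1P[->//|il].
  by rewrite inv_prodS PGL_actM extend1_tori_fixV ?IH // neq_ltn il orbT.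
case: ltnP => [ij|/fixi//]; rewrite const //.
(* This stage is above both [k] and [i]: the partial product is already the full inverse, and the
   image of [P i] has settled. *)
rewrite -(@inv_prod_packing _ _ t (k.+1 + i.+1)) ?leq_addr //.
by rewrite const // leq_addl.
Qed.

Lemma packing_set_arrow :
  packing_set (frame_tori P k) =
    [set g | frame_stab P k g /\ (fun i => PGL_act g^-1 (P i)) ~~> P].
Proof.
apply/seteqP; split=> [_ [t dt <-]|g [/frame_stabP sg arr]].
  split=> [|l ln].
    apply/frame_stabP => i ki; have := inv_prod_act k.+1 i dt.
    by rewrite ltnNge ki inv_prod_packing //= => /esym/(canLR (PGL_actVK _)).
  have := frame_act (inv_prod t l.+1) fP; congr projective_frame.
  by apply/funext => i; rewrite inv_prod_act.
(* The chain is completed by [P] at stage 0 and by the whole of g^-1 P at stages above n. *)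
pose Fr j (i : 'I_n.+1) := if (i < j)%N then PGL_act g^-1 (P i) else P i.
have fFr j : projective_frame (Fr j).
  case: j => [|j]; first exact: fP.
  have [jn|nj] := ltnP j n; first exact: arr.
  have := frame_act g^-1 fP; congr projective_frame.
  apply/funext => i; rewrite /Fr ifT //.
  by apply: leq_trans (ltn_ord i) _.
have /choice[h hP] j : exists h, forall i, PGL_act h (P i) = Fr j i.
  exact: frame_transitive.
have h0 : h 0 = 1 by apply: (PGL_act_frame_inj fP) => i; rewrite hP PGL_act1.
(* Since [g] fixes the points of index above [k], stage [k.+1] is already all of g^-1 P. *)
have hk : h k.+1 = g^-1.
  apply: (PGL_act_frame_inj fP) => i; rewrite hP /Fr.
  case: ltnP => // /sg e; by rewrite -{2}e PGL_actK.
pose t (i : 'I_k.+1) := (h i.+1)^-1 * h i.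
exists t.
  (* Stages [i] and [i.+1] differ only at index [i]. *)
  move=> i; apply/frame_torusP => l li; rewrite PGL_actM hP.
  apply: (canLR (PGL_actK _)); rewrite !hP /Fr ltnS [in RHS]leq_eqVlt.
  by rewrite (_ : (l == i :> nat) = false) //; exact/negbTE.
apply: invg_inj; rewrite -hk -(@inv_prod_packing _ _ _ k.+1) //.
suff inv_h j : (j <= k.+1)%N -> inv_prod t j = h j by rewrite inv_h.
elim: j => [|j IH] jk; first by rewrite inv_prod0 h0.
rewrite inv_prodS IH; last exact: ltnW.
by rewrite (extend1_ord _ (Ordinal jk)) /= invgM invgK mulgA mulgV mul1g.
Qed.

(** The product alone determines the chain of frames, hence the partial products and their
    consecutive quotients. *)
Lemma packing_map_inj :
  set_inj (packing_dom (frame_tori P k)) (@packing_map _ k.+1).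
Proof.
move=> t t' /set_mem dt /set_mem dt' e.
have eI j : inv_prod t j = inv_prod t' j.
  by apply: (PGL_act_frame_inj fP) => i; rewrite !inv_prod_act // e.
apply/funext => i; apply: invg_inj; have := eI i.+1.
by rewrite !inv_prodS eI => /mulgI; rewrite !extend1_ord.
Qed.

Lemma frame_tori_sub_stab i : frame_tori P k i `<=` frame_stab P k.
Proof.
move=> g /frame_torusP fix_; apply/frame_stabP => j kj; apply: fix_.
by rewrite neq_ltn orbC (leq_ltn_trans _ kj) //= -ltnS.
Qed.

(** For the identity every tuple of the chain is [P] itself. *)
Lemma packing_tori1 : packing_set (frame_tori P k) 1.
Proof.
rewrite packing_set_arrow; split; first by apply/frame_stabP => i _; rewrite PGL_act1.
move=> l _; rewrite invg1; have := fP; congr projective_frame.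
by apply/funext => i; rewrite PGL_act1 if_same.
Qed.

End Packing.

(** * Polynomial functions on End(V) *)

Section RegularFunctions.
Import GRing.Theory.
Local Open Scope ring_scope.
Variables (F : fieldType) (V : vectType F).
Local Notation E := 'End(V).
Local Notation b := (vbasis {:'End(V)}).
Implicit Types (phi psi : E -> F).

(** The domain is End(V) rather than GL(V), so that restriction to affine lines makes sense; the
    coordinates are those of the Zariski topology on GL(V). *)
Definition regular phi :=
  exists p : {mpoly F[\dim {:E}]}, forall f, phi f = p.@[fun i => coord b i f].

Lemma eq_regular phi psi : phi =1 psi -> regular phi -> regular psi.
Proof. by move=> e [p hp]; exists p => f; rewrite -e hp. Qed.

Lemma regular_cst (c : F) : regular (fun=> c).
Proof. by exists c%:MP => f; rewrite mevalC. Qed.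

Lemma regularD phi psi : regular phi -> regular psi -> regular (fun f => phi f + psi f).
Proof. by move=> [p hp] [q hq]; exists (p + q) => f; rewrite mevalD hp hq. Qed.

Lemma regularM phi psi : regular phi -> regular psi -> regular (fun f => phi f * psi f).
Proof. by move=> [p hp] [q hq]; exists (p * q) => f; rewrite mevalM hp hq. Qed.

Lemma regular_sum (I : Type) (r : seq I) (Phi : I -> E -> F) :
  (forall i, regular (Phi i)) -> regular (fun f => \sum_(i <- r) Phi i f).
Proof.
move=> rP; elim: r => [|i r IH].
  by apply: eq_regular (regular_cst 0) => f; rewrite big_nil.
by apply: eq_regular (regularD (rP i) IH) => f; rewrite big_cons.
Qed.

Lemma regular_prod (I : Type) (r : seq I) (Phi : I -> E -> F) :
  (forall i, regular (Phi i)) -> regular (fun f => \prod_(i <- r) Phi i f).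
Proof.
move=> rP; elim: r => [|i r IH].
  by apply: eq_regular (regular_cst 1) => f; rewrite big_nil.
by apply: eq_regular (regularM (rP i) IH) => f; rewrite big_cons.
Qed.

Lemma regular_det m (M : E -> 'M[F]_m) :
  (forall i j, regular (fun f => M f i j)) -> regular (fun f => \det (M f)).
Proof.
move=> rM; apply: regular_sum => s; apply: regularM; first exact: regular_cst.
by apply: regular_prod.
Qed.

Lemma regular_linear (phi : {scalar E}) : regular phi.
Proof.
exists (\sum_(i < \dim {:E}) phi b`_i *: 'X_i) => f.
rewrite {1}(coord_vbasis (memvf f)) linear_sum raddf_sum; apply: eq_bigr => i _.
by rewrite linearZ /= mevalZ mevalXU mulrC.
Qed.

Lemma coord_eval_linear (m : nat) (e : m.-tuple V) j (h : E) (v : V) :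
  linear_for *%R (fun f : E => coord e j (h (f v))).
Proof. by move=> c f g; rewrite !lfunE /= !lfunE !linearP. Qed.

Lemma regular_coord_eval (m : nat) (e : m.-tuple V) j (h : E) (v : V) :
  regular (fun f => coord e j (h (f v))).
Proof.
pose phi : {scalar E} := HB.pack (fun f : E => coord e j (h (f v)))
  (GRing.isLinear.Build _ _ _ _ _ (coord_eval_linear e j h v)).
exact: regular_linear phi.
Qed.

(** Along the line each coordinate is a polynomial of degree at most 1 in the parameter; [r] arises
    by substitution. *)
Lemma regular_line phi (f g : E) : regular phi ->
  exists r : {poly F}, forall s, phi (f + s *: g) = r.[s].
Proof.
move=> [p hp].
pose x i : {poly F} := (coord b i f)%:P + coord b i g *: 'X.
exists (\sum_(m <- msupp p) p@_m *: \prod_i x i ^+ m i) => s.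
rewrite hp mevalE horner_sum; apply: eq_bigr => m _; rewrite hornerZ horner_prod.
congr (_ * _); apply: eq_bigr => i _; rewrite horner_exp; congr (_ ^+ _).
by rewrite /x !hornerE linearD linearZ /= mulrC.
Qed.

Lemma regular_open phi : regular phi -> open [set f : GL V | phi f != 0].
Proof.
move=> [p hp]; exists [set p]; apply/seteqP; split=> f /=.
  by move=> /negP; rewrite negbK => /eqP fp _ ->; rewrite -[LHS]hp.
by move=> /(_ p erefl) fp; apply/negP; rewrite negbK hp; apply/eqP.
Qed.

(** The complement of [U] is a common zero locus, so one of its equations fails at [f]; wherever
    that equation fails, the point is in [U]. *)
Lemma open_regular (U : set (GL V)) (f : GL V) : open U -> U f ->
  exists phi, [/\ regular phi, phi f != 0 & forall g : GL V, phi g != 0 -> U g].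
Proof.
move=> [S eS] Uf; have : ~ GL_zeros S f by rewrite -eS; apply.
move=> /existsNP[p /not_implyP[Sp /eqP pf]].
exists (fun g => p.@[fun i => coord b i g]); split=> // [|g pg]; first by exists p.
apply: contrapT => nUg; have : GL_zeros S g by rewrite -eS.
by move=> /(_ p Sp) e; move: pg; rewrite [X in X != _]e eqxx.
Qed.

End RegularFunctions.

(** * Nonroots of polynomials over algebraically closed fields *)

Section InfiniteField.
Import GRing.Theory.
Local Open Scope ring_scope.

Lemma closed_field_nonroot (F : fieldType) (p : {poly F}) :
  GRing.closed_field_axiom F -> p != 0 -> exists s, p.[s] != 0.
Proof.
(* If [p] vanished everywhere, the monic associate of [p] times ['X], plus 1,
   would have no root. *)
move=> clF p0; apply: contrapT => /forallNP h.
have {}h s : p.[s] = 0 by apply/eqP; apply: contrapT => /negP; exact: h.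
have [m sp] : exists m, size p = m.+1.
  by exists (size p).-1; rewrite prednK // size_poly_gt0.
have l0 : p`_m != 0 by move: p0; rewrite -lead_coef_eq0 lead_coefE sp.
have [x] := clF m.+1 (fun i => if i is j.+1 then - (p`_j / p`_m) else -1) isT.
have := h x; rewrite horner_coef sp big_ord_recr big_ord_recl /= => /eqP.
rewrite addr_eq0 => /eqP px.
rewrite (_ : \sum_(i < m) _ = - (x / p`_m) * \sum_(i < m) p`_i * x ^+ i).
  rewrite px mulrNN [p`_m * _]mulrC mulrA mulrAC mulrVK ?unitfE //.
  rewrite -exprS expr0 mulr1 => /esym/(canRL (addrK _))/eqP.
  by rewrite subrr oppr_eq0 oner_eq0.
rewrite mulr_sumr; apply: eq_bigr => i _ /=.
by rewrite exprS !mulNr; congr (- _); rewrite mulrACA [RHS]mulrACA [x * p`_i]mulrC.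
Qed.
End InfiniteField.

(** * Closedness, openness and density in the Zariski topology *)

Section Zariski.
Import GRing.Theory.
Local Open Scope ring_scope.
Variables (F : fieldType) (V : vectType F).
Local Notation n := (\dim {:V}).
Implicit Types (A : set (ppoint V)) (X : ppoint V) (f g : GL V).

Lemma ppoint_vpick X : X = <[vpick X]>%VS :> {vspace V}.
Proof.
by apply: ppoint_vector; rewrite ?memv_pick // vpick0 -dimv_eq0 dim_ppoint.
Qed.

(** The kernel of [\1 - projv U] is [U], which yields linear equations for [U]. *)
Lemma memv_coord (U : {vspace V}) (v : V) :
  v \in U <-> forall j, coord (vbasis {:V}) j ((\1 - projv U)%VF v) = 0.
Proof.
rewrite add_lfunE opp_lfunE id_lfunE; split=> [vU j|h].
  by rewrite projv_id // subrr linear0.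
have /eqP : v - projv U v = 0.
  by rewrite (coord_vbasis (memvf (v - projv U v))) big1 // => j _; rewrite h scale0r.
by rewrite subr_eq0 => /eqP ->; exact: memv_proj.
Qed.

(** Fixing a line means sending its generator into it, a linear condition on the endomorphism. *)
Lemma PStab_closed A : closed (PStab A).
Proof.
have : closed (\pi_(PGL V)%qT @^-1` PStab A : set (GL V)).
  apply/GL_closedP; pose phi X j (f : 'End(V)) :=
    coord (vbasis {:V}) j ((\1 - projv X)%VF (f (vpick X))).
  exists [set p | exists X j, A X /\
    forall f : 'End(V), phi X j f = p.@[fun i => coord (vbasis {:'End(V)}) i f]].
  apply/seteqP; split=> f.
    move=> sf p [X [j [AX hp]]]; rewrite -[LHS]hp /phi.
    have /(GL_act_fixP _ (ppoint_vpick X)) : GL_act f X = X.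
      by rewrite -PGL_act_pi sf.
    by rewrite -ppoint_vpick => /memv_coord ->.
  move=> zf X AX; rewrite PGL_act_pi; apply/(GL_act_fixP _ (ppoint_vpick X)).
  rewrite -ppoint_vpick; apply/memv_coord => j.
  have [p hp] := regular_coord_eval (vbasis {:V}) j (\1 - projv X)%VF (vpick X).
  by rewrite [LHS]hp; apply: zf; exists X, j.
by rewrite -openC -(openC (PStab A)) preimage_setC.
Qed.

Lemma coord_det_regular (w : 'End(V) -> 'I_n -> V) :
  (forall i j, regular (fun f : 'End(V) => coord (vbasis {:V}) j (w f i))) ->
  regular (fun f : 'End(V) => coord_det (w f)).
Proof.
by move=> rw; apply: regular_det => i j; apply: eq_regular (rw i j) => f; rewrite mxE.
Qed.

Lemma regular_coord_apply j (v : V) :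
  regular (fun f : 'End(V) => coord (vbasis {:V}) j (f v)).
Proof.
by apply: eq_regular (regular_coord_eval (vbasis {:V}) j \1%VF v) => f; rewrite id_lfunE.
Qed.

(** The factor at [l] and [m] tests the [l]-th tuple of the chain from [P] to its image under [f],
    with the point of index [m] omitted. *)
Definition arrow_det (u : 'I_n.+1 -> V) (f : 'End(V)) : F :=
  \prod_(l < n) \prod_(m < n.+1)
    coord_det (fun i => if (lift m i <= l)%N then u (lift m i) else f (u (lift m i))).

Lemma arrow_det_regular u : regular (arrow_det u).
Proof.
apply: regular_prod => l; apply: regular_prod => m; apply: coord_det_regular => i j.
by case: (lift m i <= l)%N; [exact: regular_cst|exact: regular_coord_apply].
Qed.

Lemma arrow_detP (u : 'I_n.+1 -> V) (P : 'I_n.+1 -> ppoint V) f :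
  (forall i, P i = <[u i]>%VS :> {vspace V}) ->
  arrow_det u f != 0 <-> P ~~> (fun i => PGL_act (\pi_(PGL V)%qT f) (P i)).
Proof.
move=> Pu; pose w (l : nat) (i : 'I_n.+1) :=
  if (i <= l)%N then u i else (f : 'End(V)) (u i).
have Pw l (i : 'I_n.+1) :
    (if (i <= l)%N then P i else PGL_act (\pi_(PGL V)%qT f) (P i)) =
    <[w l i]>%VS :> {vspace V}.
  by rewrite /w; case: ifP => _; rewrite ?PGL_act_pi; [exact: Pu|exact: GL_act_vector].
split=> [/prodf_neq0 h l ln|h].
  apply/(frame_freeP (Pw l)) => m; rewrite -coord_det_neq0.
  by have /prodf_neq0/(_ m isT) := h (Ordinal ln) isT.
apply/prodf_neq0 => l _; apply/prodf_neq0 => m _.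
by have /(frame_freeP (Pw l))/(_ m) := h l (ltn_ord l); rewrite -coord_det_neq0.
Qed.

Lemma frame_vectors (P : 'I_n.+1 -> ppoint V) :
  exists u : 'I_n.+1 -> V, forall i, P i = <[u i]>%VS :> {vspace V}.
Proof. by exists (fun i => vpick (P i)) => i; exact: ppoint_vpick. Qed.

Lemma arrow_open (P : 'I_n.+1 -> ppoint V) :
  open [set g : PGL V | P ~~> (fun i => PGL_act g (P i))].
Proof.
have [u Pu] := frame_vectors P; have := regular_open (arrow_det_regular u).
congr open; apply/seteqP.
by split=> f; [exact: (arrow_detP f Pu).1|exact: (arrow_detP f Pu).2].
Qed.

(** An endomorphism is invertible exactly when the images of a basis span, that is, when their
    coordinate determinant is nonzero. *)
Lemma det_regular : exists2 phi : 'End(V) -> F, regular phi &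
  forall f : 'End(V), (phi f != 0) = (lker f == 0%VS).
Proof.
exists (fun f : 'End(V) => coord_det (fun i => f (vbasis {:V})`_i)).
  by apply: coord_det_regular => i j; exact: regular_coord_apply.
move=> f; rewrite coord_det_neq0 free_mktuple_fullv.
rewrite (_ : <<_>>%VS = (f @: fullv)%VS).
  apply/eqP/idP => [/full_GL//|/eqP k0]; exact/lker0_limgf/eqP.
rewrite span_mktuple -[X in (f @: X)%VS](span_basis (vbasisP {:V})) span_def big_tuple.
rewrite limg_sum; apply: eq_bigr => i _.
by rewrite limg_line (tnth_nth 0).
Qed.

(** The points other than [P k] provide a basis of V, and fixing them means being diagonal in it. *)
Lemma frame_torus_split (P : 'I_n.+1 -> ppoint V) (k : 'I_n.+1) :
  projective_frame P -> split_maximal_torus (frame_torus P k).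
Proof.
move=> fP; have [u Pu] := frame_vectors P.
have /(_ k) freeu := (frame_freeP Pu).1 fP.
exists [tuple u (lift k i) | i < n].
  by rewrite basisEfree freeu subvf size_tuple leqnn.
have fixP f : frame_torus P k (\pi_(PGL V)%qT f) <->
    forall i : 'I_n, exists c, (f : 'End(V)) (u (lift k i)) = c *: u (lift k i).
  split=> [/frame_torusP h i|h].
    apply/vlineP/(GL_act_fixP _ (Pu _)); rewrite -PGL_act_pi h //.
    by rewrite eq_sym neq_lift.
  apply/frame_torusP => i; rewrite eq_sym => /unlift_some[j -> _].
  by rewrite PGL_act_pi; apply/(GL_act_fixP _ (Pu _))/vlineP.
apply/seteqP; split=> [|_ [f h <-]].
  elim/PGLW => f /fixP h; exists f => // i.
  by rewrite tnth_mktuple.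
by apply/fixP => i; have := h i; rewrite tnth_mktuple.
Qed.

Variables (P : 'I_n.+1 -> ppoint V) (k : 'I_n.+1).
Hypothesis fP : projective_frame P.

Lemma packing_set_arrow_act :
  packing_set (frame_tori P k) =
    [set g | frame_stab P k g /\ P ~~> (fun i => PGL_act g (P i))].
Proof.
rewrite packing_set_arrow //; apply/seteqP.
by split=> g [sg /frame_arrow_act].
Qed.

Lemma packing_set_open : open_in (frame_stab P k) (packing_set (frame_tori P k)).
Proof.
exists [set g : PGL V | P ~~> (fun i => PGL_act g (P i))].
  exact: arrow_open.
exact: packing_set_arrow_act.
Qed.

(* In GL(V) the group [frame_stab P k] is the trace of a linear subspace of
   ['End(V)], so that a nonempty open subset meets every neighbourhood along a
   line, here the line joining a given point to the identity. *)
Lemma packing_set_dense : GRing.closed_field_axiom F ->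
  dense_in (frame_stab P k) (packing_set (frame_tori P k)).
Proof.
move=> clF; rewrite packing_set_arrow_act; split=> [g []//|g].
have [u Pu] := frame_vectors P.
have [det rdet detP] := det_regular.
elim/PGLW: g => f sf B; rewrite nbhsE => -[U [oU Uf] UB].
have [phi [rphi phif phiU]] :=
  open_regular (oU : open (\pi_(PGL V)%qT @^-1` U : set (GL V))) Uf.
(* The line is at [f] for parameter 0 and at the identity for parameter 1. Three polynomials on it
   ensure membership in [U], invertibility and the chain of frames; the first two are nonzero at 0,
   the third at 1. *)
have line chi : regular chi -> exists r : {poly F}, forall s,
    chi ((f : 'End(V)) + s *: (\1%VF - (f : 'End(V)))) = r.[s].
  exact: regular_line.
have [r1 hr1] := line _ rphi; have [r2 hr2] := line _ rdet.
have [r3 hr3] := line _ (arrow_det_regular u).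
have r10 : r1 != 0.
  by apply: contraNneq phif => r0; move: (hr1 0); rewrite scale0r addr0 r0 horner0 => ->.
have r20 : r2 != 0.
  have : det f != 0 by rewrite detP GL_ker.
  by apply: contraNneq => r0; move: (hr2 0); rewrite scale0r addr0 r0 horner0 => ->.
have r30 : r3 != 0.
  have : arrow_det u \1%VF != 0.
    have := packing_tori1 k fP; rewrite packing_set_arrow_act => -[_ h].
    exact: (arrow_detP (1%g : GL V) Pu).2.
  by apply: contraNneq => r0; move: (hr3 1); rewrite scale1r addrC subrK r0 horner0 => ->.
have [s] := closed_field_nonroot clF (mulf_neq0 r10 (mulf_neq0 r20 r30)).
rewrite !hornerM !mulf_eq0 !negb_or -hr1 -hr2 -hr3 detP => /and3P[phis dets arrs].
pose h := MkGL dets; exists (\pi_(PGL V)%qT h); split.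
  split; last exact: (arrow_detP h Pu).1.
  (* Both [f] and the identity map [P i] into itself, hence so do their linear combinations. *)
  apply/frame_stabP => i ki; rewrite PGL_act_pi; apply/(GL_act_fixP _ (Pu i)).
  have fi : (f : 'End(V)) (u i) \in <[u i]>%VS.
    apply/(GL_act_fixP _ (Pu i)); rewrite -PGL_act_pi.
    exact: (frame_stabP _ _ _).1 sf i ki.
  rewrite /= add_lfunE scale_lfunE add_lfunE opp_lfunE id_lfunE.
  by rewrite rpredD // rpredZ // rpredB // memv_line.
exact/UB/phiU.
Qed.

Lemma packing_dense : GRing.closed_field_axiom F ->
  dense_packing (frame_tori P k) (frame_stab P k).
Proof.
move=> clF; split; first exact: PStab_subgroup.
- by move=> i; split; [exact: PStab_subgroup|exact: frame_tori_sub_stab].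
- exact: packing_map_inj.
- exact: packing_set_dense.
Qed.

End Zariski.

Theorem proposition4p17 (F : fieldType) (V : vectType F) (n : nat)
    (P : 'I_n.+1 -> ppoint V) :
  \dim {:V} = n -> (2 <= n)%N -> projective_frame P ->
  [/\ forall k : 'I_n.+1,
        [/\ split_maximal_torus (frame_torus P k),
            is_subgroup (frame_stab P k) &
            closed (frame_stab P k)],
      forall k : 'I_n.+1,
        packing_set (frame_tori P k) =
          [set g | frame_stab P k g /\
                   (fun i => PGL_act g^-1%g (P i)) ~~> P] /\
        packing_set (frame_tori P k) =
          [set g | frame_stab P k g /\
                   P ~~> (fun i => PGL_act g (P i))] &
      GRing.closed_field_axiom F ->
        (forall k : 'I_n.+1,
          [/\ packing_set (frame_tori P k) !=set0,
              open_in (frame_stab P k) (packing_set (frame_tori P k)) &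
              dense_packing (frame_tori P k) (frame_stab P k)]) /\
        dense_packing (frame_torus P) setT].
Proof.
move=> dimV; case: n / dimV P => P _ fP; split=> [k|k|clF].
- by split; [exact: frame_torus_split|exact: PStab_subgroup|exact: PStab_closed].
- by split; [exact: packing_set_arrow|exact: packing_set_arrow_act].
split=> [k|].
  split; [|exact: packing_set_open|exact: packing_dense].
  by exists 1%g; exact: packing_tori1.
have := packing_dense ord_max fP clF.
(* No index exceeds n, so H_n is the stabiliser of the empty set. *)
have -> : frame_stab P ord_max = setT.
  by apply/seteqP; split=> // g _; apply/frame_stabP => i; rewrite ltnNge -ltnS ltn_ord.
congr (dense_packing _ _); apply/funext => i; congr (frame_torus P _).
Qed.
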